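(* Let $q$ be a prime power and let $d,r>0$ be integers with $d\mid (q-1)$. Suppose that $q=q_0^m$, where $q_0$ is a prime power and $m$ a positive integer with $q_0\equiv 1\pmod d$ and $d\mid m$, and let $h\in\mathbb{F}_{q_0}[x]$. Then $f(x):=x^r h(x^{(q-1)/d})$ permutes $\mathbb{F}_q$ if and only if $\gcd(r,(q-1)/d)=1$ and $h$ has no roots in $\mu_d$.
   Context: For a positive integer $n$, $\mu_n$ denotes the set of all $n$-th roots of unity in a fixed algebraic closure of $\mathbb{F}_q$, i.e. all $z$ with $z^n=1$. A polynomial over $\mathbb{F}_q$ permutes $\mathbb{F}_q$ if the induced map $\mathbb{F}_q\to\mathbb{F}_q$ is a bijection. Here $\mathbb{F}_{q_0}$ is viewed as a subfield of $\mathbb{F}_q$. *)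

(* Defs.v *)
From mathcomp Require Import all_boot all_algebra.

Set Implicit Arguments.
Unset Strict Implicit.
Unset Printing Implicit Defensive.

Import GRing.Theory.
Local Open Scope ring_scope.

Definition permutes (F : finFieldType) (f : {poly F}) : Prop :=
  bijective (fun x : F => f.[x]).

(* [closedFieldType] only gives algebraic closedness; an algebraic closure of
   [F] must in addition be algebraic over the image of [F]. *)
Definition is_algebraic_closure (F : fieldType) (L : closedFieldType)
    (iota : {rmorphism F -> L}) : Prop :=
  forall z : L, algebraicOver iota z.

(* Main.v *)
Require Import Defs.
From mathcomp Require Import all_boot all_algebra.
From mathcomp Require Import cyclic finfield.

(** Put [s = (q - 1) / d]. The map [x |-> x^s] sends the nonzero elements of
    [F] onto [mu_d], and [f(x) = x^r h(x^s)].

    Necessity uses only injectivity. A primitive root of unity [zeta] of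
    order [gcd(r, s)] satisfies [zeta^r = zeta^s = 1], so that [f(zeta) = f(1)]
    and [zeta = 1], which means that this gcd is 1. A root of [h] in [mu_d] has the form [x^s] with [x != 0], so that [f(x) = 0 = f(0)].

    For sufficiency, the hypotheses on [q0] make [h(x^s)] invisible after raising
    to the power [s]. Since [d] divides [q0 - 1], the group [mu_d] lies in
    [F0], hence [h] takes values in [F0] on [mu_d]. Moreover
    [q - 1 = (q0 - 1) (1 + q0 + ... + q0^(m-1))], where the second factor is
    congruent to [m], hence to [0], modulo [d]; therefore [q0 - 1] divides [s]
    ([dvdn_pred_exp_div]) and [y^s = 1] for every nonzero [y] in [F0]. It follows
    that [f(x)^s = x^(r s)] for [x != 0]. As [d] divides [q0 - 1], which divides
    [s], coprimality of [r] with [s] also gives coprimality with [d]; then [f(x)]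
    determines first [x^s], next [x^r], and finally [x].

    The inclusion of [mu_d] in [F0] and the lifting of elements of [mu_d] to
    [s]-th powers both come from [mul_closed_prim_root], applied to the
    nonzero elements of [F0] and of [F]. *)

Set Implicit Arguments.
Unset Strict Implicit.
Unset Printing Implicit Defensive.

Import GRing.Theory.
Local Open Scope ring_scope.

(** * Arithmetic of the exponents *)

(** The cofactor [1 + a + ... + a^(m-1)] of [a - 1] in [a^m - 1] is a sum of [m]
    terms congruent to [1], so it absorbs the division by [d]. *)
Lemma dvdn_pred_exp_div (a m d : nat) :
  a = 1 %[mod d] -> (d %| m)%N ->
  (a.-1 %| (a ^ m).-1 %/ d)%N.
Proof.
move=> a1 dm; rewrite predn_exp.
have dsum : (d %| \sum_(i < m) a ^ i)%N.
  rewrite /dvdn -modn_summ.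
  under eq_bigr => i _ do rewrite -modnXm a1 modnXm exp1n.
  by rewrite modn_summ sum1_card card_ord.
by rewrite -muln_divA // dvdn_mulr.
Qed.

(** * Roots of unity in a field *)

Lemma expf_coprime_eq1 (F : fieldType) (x : F) (a b : nat) :
  (0 < a)%N -> coprime a b -> x ^+ a = 1 -> x ^+ b = 1 -> x = 1.
Proof.
move=> a_gt0 /eqP ab xa xb.
case: (egcdnP b a_gt0) => u v; rewrite ab => uv _.
have : x ^+ (u * a) = x ^+ (v * b + 1) by rewrite uv.
by rewrite exprD mulnC exprM xa mulnC exprM xb !expr1n mul1r expr1.
Qed.

(** Multiplication by [y] permutes [G], so the product over [G] is unchanged
    when each of its factors is multiplied by [y]. *)
Lemma mul_closed_expf_card (F : finFieldType) (G : {set F}) (y : F) :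
  0 \notin G -> {in G &, forall x y, x * y \in G} -> y \in G -> y ^+ #|G| = 1.
Proof.
move=> G0 GM Gy; have nz x : x \in G -> x != 0 by apply: contraTneq => ->.
have yI : injective ( *%R y) by apply: mulfI; apply: nz.
have imG : [set y * x | x in G] = G.
  apply/eqP; rewrite eqEcard card_imset // leqnn andbT.
  by apply/subsetP => _ /imsetP[x Gx ->]; apply: GM.
have P0 : \prod_(x in G) x != 0 by apply/prodf_neq0 => x /nz.
apply: (mulIf P0); rewrite mul1r -prodr_const -big_split /= -[in RHS]imG.
by rewrite big_imset //= => ? ? _ _ /yI.
Qed.

(** A set [G] of nonzero elements closed under products consists of roots of unity of order dividing [#|G|], as many
    as a field can hold, and this forces a primitive one among them. *)
Lemma mul_closed_prim_root (F : finFieldType) (G : {set F}) :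
  0 \notin G -> 1 \in G -> {in G &, forall x y, x * y \in G} ->
  exists2 g, g \in G & #|G|.-primitive_root g.
Proof.
move=> G0 G1 GM; have /hasP[g] : has #|G|.-primitive_root (enum G).
  apply: has_prim_root; rewrite ?enum_uniq -?cardE //.
    by apply/card_gt0P; exists 1.
  apply/allP => y; rewrite mem_enum => Gy; apply/unity_rootP.
  exact: mul_closed_expf_card.
by rewrite mem_enum; exists g.
Qed.

Lemma expf_card_pred (F : finFieldType) (x : F) : x != 0 -> x ^+ #|F|.-1 = 1.
Proof.
move=> x0; apply: (mulfI x0).
by rewrite mulr1 -exprS prednK ?expf_card // ltnW // finNzRing_gt1.
Qed.

Lemma finField_prim_root (F : finFieldType) :
  exists g : F, #|F|.-1.-primitive_root g.
Proof.
have cG : #|[set x : F | x != 0]| = #|F|.-1.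
  by rewrite cardsE -(cardC1 (0 : F)); apply: eq_card => x; rewrite !inE.
have [||x y|g _] := @mul_closed_prim_root F [set x | x != 0].
- by rewrite inE eqxx.
- by rewrite inE oner_neq0.
- by rewrite !inE => x0 y0; rewrite mulf_neq0.
by rewrite cG; exists g.
Qed.

(** The nonzero elements of [F0] are exactly the roots in [F] of
    [X^n - 1] for [n = #|F0| - 1]: a root of this polynomial is a power of a primitive one,
    and there is a primitive one in [F0]. *)
Lemma divring_unity_root (F : finFieldType) (F0 : divringClosed F) (x : F) :
  #|F0|.-1.-unity_root x = (x \in F0) && (x != 0).
Proof.
pose G := [set y in F0 | y != 0].
have cG : #|G| = #|F0|.-1.
  rewrite (cardD1 0 F0) rpred0 cardsE; apply: eq_card => y.
  by rewrite !inE andbC.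
have G0 : 0 \notin G by rewrite inE eqxx andbF.
have G1 : 1 \in G by rewrite inE rpred1 oner_neq0.
have GM : {in G &, forall y z, y * z \in G}.
  move=> y z; rewrite !inE => /andP[Fy y0] /andP[Fz z0].
  by rewrite rpredM // mulf_neq0.
have -> : (x \in F0) && (x != 0) = (x \in G) by rewrite inE.
rewrite -cG; apply/unity_rootP/idP => [|Gx]; last exact: mul_closed_expf_card.
have [g Gg gP] := mul_closed_prim_root G0 G1 GM.
case/(prim_rootP gP) => i ->; move: Gg; rewrite !inE => /andP[Fg g0].
by rewrite rpredX // expf_neq0.
Qed.

(** Primitivity of a generator of the multiplicative group survives in every
    extension, so the roots of unity of order dividing [#|F| - 1] in [L] are powers
    of its image; being killed by [d] forces the exponent to be a multiple of
    [s]. *)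
Lemma unity_root_lift (F : finFieldType) (L : fieldType)
    (iota : {rmorphism F -> L}) (d s : nat) (z : L) :
  (s * d = #|F|.-1)%N -> z ^+ d = 1 -> exists2 x : F, x != 0 & z = iota (x ^+ s).
Proof.
move=> sd zd; have [g gP] := finField_prim_root F.
have gP' : #|F|.-1.-primitive_root (iota g) by rewrite fmorph_primitive_root.
have d_gt0 : (0 < d)%N.
  by have := prim_order_gt0 gP; rewrite -sd muln_gt0 => /andP[].
have [|i zE] := prim_rootP gP' (x := z).
  by rewrite -sd mulnC exprM zd expr1n.
have : (s %| i)%N.
  rewrite -(dvdn_pmul2r d_gt0) sd (prim_order_dvd gP').
  by rewrite exprM -zE zd.
case/dvdnP => k ik; exists (g ^+ k).
  rewrite expf_neq0 //; apply: contra_eq_neq (prim_expr_order gP) => ->.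
  by rewrite expr0n eqn0Ngt (prim_order_gt0 gP) eq_sym oner_eq0.
by rewrite zE ik exprM !rmorphXn.
Qed.

(** * The polynomial [x^r h(x^s)] *)

Lemma horner_XnM_comp_Xn (R : comNzRingType) (h : {poly R}) (r s : nat) (x : R) :
  ('X^r * (h \Po 'X^s)).[x] = x ^+ r * h.[x ^+ s].
Proof. by rewrite hornerM horner_comp !hornerXn. Qed.

(** A root of unity of order [gcd(r, s)] has the same image as [1]. *)
Lemma permutes_coprime (F : finFieldType) (h : {poly F}) (r s : nat) :
  (s %| #|F|.-1)%N -> permutes ('X^r * (h \Po 'X^s)) -> coprime r s.
Proof.
move=> sF /bij_inj fI; have [g gP] := finField_prim_root F.
have := dvdn_prim_root gP (dvdn_trans (dvdn_gcdr r s) sF).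
set zeta := g ^+ _ => zetaP.
have zr : zeta ^+ r = 1 by apply/eqP; rewrite -(prim_order_dvd zetaP) dvdn_gcdl.
have zs : zeta ^+ s = 1 by apply/eqP; rewrite -(prim_order_dvd zetaP) dvdn_gcdr.
have z1 : zeta = 1 by apply: fI; rewrite !horner_XnM_comp_Xn zr zs !expr1n.
by rewrite /coprime -dvdn1 (prim_order_dvd zetaP) z1 expr1n.
Qed.

(** Otherwise [x] would be sent to [0], which is already the image of [0]. *)
Lemma permutes_neq0 (F : finFieldType) (h : {poly F}) (r s : nat) (x : F) :
  (0 < r)%N -> permutes ('X^r * (h \Po 'X^s)) -> x != 0 -> h.[x ^+ s] != 0.
Proof.
move=> r_gt0 /bij_inj fI; apply: contra_neq => hx; apply: fI.
by rewrite !horner_XnM_comp_Xn hx mulr0 expr0n eqn0Ngt r_gt0 mul0r.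
Qed.

(** When the values of [h] are killed by the exponent [s], comparing the [s]-th
    powers of [f(x) = f(y)] shows that the order of [x / y] divides [r s]; it
    also divides [d s = #|F| - 1], hence [s] since [r] and [d] are coprime.
    Then [h(x^s) = h(y^s)] cancels and leaves [x^r = y^r]. *)
Lemma permutes_expf_eq1 (F : finFieldType) (h : {poly F}) (r s d : nat) :
  (0 < r)%N -> (s * d = #|F|.-1)%N -> coprime r s -> coprime r d ->
  (forall x : F, x != 0 -> h.[x ^+ s] ^+ s = 1) ->
  permutes ('X^r * (h \Po 'X^s)).
Proof.
move=> r_gt0 sd rs rd hs.
have F1_gt0 : (0 < #|F|.-1)%N by rewrite -subn1 subn_gt0 finNzRing_gt1.
have s_gt0 : (0 < s)%N by move: F1_gt0; rewrite -sd muln_gt0 => /andP[].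
have h0 x : x != 0 -> h.[x ^+ s] != 0.
  move=> /hs; apply: contra_eq_neq => ->.
  by rewrite expr0n eqn0Ngt s_gt0 eq_sym oner_eq0.
apply: injF_bij => x y; rewrite !horner_XnM_comp_Xn.
have [-> | x0] := eqVneq x 0; have [-> | y0] := eqVneq y 0 => //.
- rewrite expr0n eqn0Ngt r_gt0 mul0r => /esym/eqP.
  by rewrite mulf_eq0 (negPf (h0 _ y0)) orbF expf_eq0 r_gt0 => /eqP.
- rewrite [0 ^+ r]expr0n eqn0Ngt r_gt0 mul0r => /eqP.
  by rewrite mulf_eq0 (negPf (h0 _ x0)) orbF expf_eq0 r_gt0 => /eqP.
move=> fxy; apply/(divIf y0); rewrite divff //.
have xys : (x / y) ^+ s = 1.
  apply: (expf_coprime_eq1 r_gt0 rd).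
    have := congr1 (fun z => z ^+ s) fxy.
    rewrite /= !exprMn !hs // !mulr1 exprAC [RHS]exprAC => xyrs.
    by rewrite !exprVn xyrs divff // !expf_neq0.
  by rewrite -exprM sd expf_card_pred // mulf_neq0 ?invr_eq0.
apply: (expf_coprime_eq1 r_gt0 rs) => //.
have xsys : x ^+ s = y ^+ s.
  by apply/(divIf (expf_neq0 s y0)); rewrite -expr_div_n xys divff ?expf_neq0.
move: fxy; rewrite xsys => /(mulIf (h0 _ y0)) xr.
by rewrite expr_div_n xr divff ?expf_neq0.
Qed.

Theorem theorem1p2 (F : finFieldType) (F0 : divringClosed F)
    (L : closedFieldType) (iota : {rmorphism F -> L})
    (hL : is_algebraic_closure iota)
    (q q0 m d r : nat) (hq : #|F| = q) (hq0 : #|F0| = q0)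
    (hd : (0 < d)%N) (hr : (0 < r)%N) (hdq : (d %| q - 1)%N)
    (hm : (0 < m)%N) (hqm : q = (q0 ^ m)%N)
    (hq0d : q0 = 1 %[mod d]) (hdm : (d %| m)%N)
    (h : {poly F}) (hh : h \is a polyOver F0) :
  permutes ('X^r * (h \Po 'X^((q - 1) %/ d))) <->
  gcdn r ((q - 1) %/ d) = 1%N /\
  (forall z : L, d.-unity_root z -> ~~ root (map_poly iota h) z).
Proof.
have sE : ((q - 1) %/ d * d = #|F|.-1)%N by rewrite divnK // hq subn1.
set s := ((q - 1) %/ d)%N in sE *.
have sF : (s %| #|F|.-1)%N by rewrite -sE dvdn_mulr.
have root_iota x : root (map_poly iota h) (iota x) = (h.[x] == 0).
  by rewrite /root horner_map fmorph_eq0.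
split=> [fP | [/eqP rs h_mu]].
  split=> [|z /unity_rootP zd]; first exact/eqP/(permutes_coprime sF fP).
  have [x x0 ->] := unity_root_lift iota sE zd.
  by rewrite root_iota (permutes_neq0 hr fP).
have q0_gt0 : (0 < q0)%N by rewrite -hq0; apply/card_gt0P; exists 0; apply: rpred0.
have dq0 : (d %| q0.-1)%N by rewrite -subn1 -eqn_mod_dvd //; apply/eqP.
have q0s : (q0.-1 %| s)%N.
  by rewrite /s hqm subn1 dvdn_pred_exp_div.
have rd : coprime r d := coprime_dvdr (dvdn_trans dq0 q0s) rs.
apply: (permutes_expf_eq1 hr sE rs rd) => x x0.
have xsd : (x ^+ s) ^+ d = 1 by rewrite -exprM sE expf_card_pred.
have F0xs : x ^+ s \in F0.
  have : #|F0|.-1.-unity_root (x ^+ s).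
    by apply/unity_rootP; rewrite hq0 -(divnK dq0) mulnC exprM xsd expr1n.
  by rewrite divring_unity_root => /andP[].
have hxs0 : h.[x ^+ s] != 0.
  rewrite -root_iota; apply: h_mu; apply/unity_rootP.
  by rewrite -rmorphXn xsd rmorph1.
have : #|F0|.-1.-unity_root h.[x ^+ s].
  by rewrite divring_unity_root hxs0 rpred_horner.
move/unity_rootP; rewrite hq0 => hq01.
by rewrite -[X in _ ^+ X = _](divnK q0s) mulnC exprM hq01 expr1n.
Qed.
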